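(* Let $\Gamma$ be a finite group and let $k$ denote the minimum dimension of a non-trivial representation of $\Gamma$. If $A$ is a product-free set in $\Gamma$, then we have $$|A|\ \le\ \frac{|\Gamma|}{1+k^{1/3}}.$$
   Context: A subset $A$ of a group $\Gamma$ is product-free if $uv\notin A$ for all $u,v\in A$. *)

(* Defs.v *)
From mathcomp Require Import all_boot all_order all_algebra all_fingroup.
From mathcomp Require Import mxrepresentation.
From mathcomp.real_closed Require Import complex.
From mathcomp Require Import reals exp.

Set Implicit Arguments.
Unset Strict Implicit.
Unset Printing Implicit Defensive.

Import GroupScope.

Definition product_free (gT : finGroupType) (A : {set gT}) : Prop :=
  forall u v : gT, u \in A -> v \in A -> u * v \notin A.

(* [rker rG] is the set of elements of G acting as the identity. *)
Definition nontrivial_repr (F : fieldType) (gT : finGroupType) (G : {group gT})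
    (n : nat) (rG : mx_representation F G n) : Prop :=
  ~~ (G \subset rker rG).

Definition has_nontrivial_repr (F : fieldType) (gT : finGroupType)
    (G : {group gT}) (n : nat) : Prop :=
  exists rG : mx_representation F G n, nontrivial_repr rG.

(* A relation rather than a function: the trivial group has no nontrivial
   representation, hence no minimum dimension.  A nontrivial representation is
   only required to move something, so it need not be irreducible. *)
Definition min_nontrivial_dim (F : fieldType) (gT : finGroupType)
    (G : {group gT}) (k : nat) : Prop :=
  has_nontrivial_repr F G k /\
  forall n : nat, has_nontrivial_repr F G n -> k <= n.

(* Main.v *)
Require Import Defs.
From mathcomp Require Import all_boot all_order all_algebra all_fingroup.
From mathcomp Require Import mxrepresentation sesquilinear spectral.
From mathcomp.real_closed Require Import complex.
From mathcomp Require Import reals exp.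
From mathcomp Require Import ring.

Set Implicit Arguments.
Unset Strict Implicit.
Unset Printing Implicit Defensive.

Import Order.TTheory GRing.Theory Num.Theory.
Local Open Scope ring_scope.
Local Open Scope sesquilinear_scope.

(** This is Gowers' spectral argument for quasirandom groups.  Write [n] for
    the order of the group [G] and, for a function [g] on [G], let [N] be the
    Cayley matrix with entries [g (x * y^-1)].  It commutes with the regular
    representation, hence so does the Hermitian matrix [N N^*], whose
    eigenspaces are therefore subrepresentations.  If [g] has sum 0 then
    [N N^*] kills the constant vectors, which are the only vectors fixed by
    the regular representation; so the eigenspace of a nonzero eigenvalue is a
    nontrivial representation and has dimension at least [k]
    ([min_dim_le_rank_eigenspace]).  The eigenvalues are nonnegative and their
    sum, the trace, is [n |g|^2]; as each nonzero one is repeated at least [k]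
    times, none exceeds [n |g|^2 / k] ([dot_mulmx_le]).  With the
    Cauchy-Schwarz inequality this gives the mixing inequality
    ([quasirandom_mixing])
    [[ k |sum_(x, y) f(x) g(x y^-1) h(y)|^2 <= n |f|^2 |g|^2 |h|^2 ]].

    Take for [f], [g] and [h] the balanced indicator of [A], that is
    [1_A - al] where [al = |A| / n].  Product-freeness makes the triple sum of
    [1_A] itself vanish, so the sum on the left is [- al |A|^2], while each
    squared norm on the right is [|A| (n - |A|) / n].  What remains is
    [k |A|^3 <= (n - |A|)^3] ([product_free_card]), whose cube root is the
    announced bound. *)

Local Notation "''[' u ]" := (dotmx u u) : ring_scope.

(** * Eigenvalues of high multiplicity *)

Lemma dotmx_normE (C : numClosedFieldType) (n : nat) (u : 'rV[C]_n) :
  '[u] = \sum_i `|u 0 i| ^+ 2.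
Proof.
by rewrite dotmxE mxE; apply: eq_bigr => i _; rewrite !mxE normCK.
Qed.

Lemma rank_le_supp (F : fieldType) (m n : nat) (D : {set 'I_n})
    (M : 'M[F]_(m, n)) :
  (forall i j, j \notin D -> M i j = 0) -> (\rank M <= #|D|)%N.
Proof.
move=> M0; have sMD : (M <= \matrix_(i < #|D|) delta_mx 0 (enum_val i))%MS.
  apply/row_subP=> i; rewrite (row_sum_delta (row i M)); apply: summx_sub => j _.
  have [Dj|D'j] := boolP (j \in D); last by rewrite mxE M0 // scale0r sub0mx.
  apply: scalemx_sub; apply: eq_row_sub (enum_rank_in Dj j) _.
  by rewrite rowK enum_rankK_in.
exact: leq_trans (mxrankS sMD) (rank_leq_row _).
Qed.

(** The eigenvalues of [N N^*] are nonnegative and sum to its trace, so one that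
    occurs at least [k] times is at most the trace divided by [k].  Expanding
    [v] in an orthonormal basis of eigenvectors then bounds [|v N|^2], which is
    the quadratic form of [N N^*] at [v]. *)
Lemma dot_mulmx_le (C : numClosedFieldType) (n k : nat) (N : 'M[C]_n) :
  (forall a, a != 0 -> eigenvalue (N *m N^t*) a ->
     (k <= \rank (eigenspace (N *m N^t*) a))%N) ->
  forall v, k%:R * '[v *m N] <= \tr (N *m N^t*) * '[v].
Proof.
set B := N *m N^t* => mult_ge v.
have nB : B \is normalmx.
  by apply/normalmxP; rewrite /B trmx_mul map_mxM trmxCK.
set P := spectralmx B; set d := spectral_diag B.
have uP : P \is unitarymx := spectral_unitarymx B.
have defB : B = P^t* *m diag_mx d *m P.
  by rewrite -invmx_unitary //; apply/orthomx_spectralP.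
have PP : P *m P^t* = 1%:M by apply/unitarymxP.
have PB i : row i P *m B = d 0 i *: row i P.
  by rewrite defB !mulmxA -row_mul PP row1 -rowE row_diag_mx -scalemxAl -rowE.
have dE i : d 0 i = '[row i P *m N].
  rewrite dotmxE trmx_mul map_mxM !mulmxA -(mulmxA (row i P)) -/B PB.
  by rewrite -scalemxAl mxE -dotmxE (row_unitarymxP uP) eqxx mulr1.
have d_ge0 i : 0 <= d 0 i.
  by rewrite dE dotmx_normE sumr_ge0 // => j _; rewrite exprn_ge0.
have trB : \tr B = \sum_i d 0 i.
  by rewrite defB mxtrace_mulC mulmxA PP mul1mx mxtrace_diag.
have kd i : k%:R * d 0 i <= \tr B.
  have [->|nz_di] := eqVneq (d 0 i) 0.
    by rewrite mulr0 trB sumr_ge0.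
  pose D := [set j | d 0 j == d 0 i].
  (* In the eigenbasis, the eigenspace of [d 0 i] is supported on [D]. *)
  have k_le : (k <= #|D|)%N.
    apply: leq_trans (mult_ge _ nz_di _) _.
      apply/eigenvalueP; exists (row i P) => //.
      apply/eqP=> P0; have := row_unitarymxP uP i i.
      by rewrite P0 dotmx_normE eqxx big1 => [/eqP|j _];
        rewrite ?(eq_sym 0) ?oner_eq0 // mxE normr0 expr0n.
    set E := eigenspace B _.
    have fPt : row_free (P^t*).
      by rewrite row_free_unit unitarymx_unit // trmxC_unitary.
    rewrite -(mxrankMfree E fPt).
    apply: rank_le_supp => r j; rewrite inE => neq_d.
    have /eigenspaceP EB : (E <= eigenspace B (d 0 i))%MS by [].
    have /matrixP/(_ r j) : E *m P^t* *m diag_mx d = d 0 i *: (E *m P^t*).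
      by rewrite scalemxAl -EB defB !mulmxA mulmxtVK.
    rewrite mul_mx_diag !mxE => /eqP; rewrite mulrC -subr_eq0 -mulrBl mulf_eq0.
    by rewrite subr_eq0 (negPf neq_d) => /eqP.
  apply: le_trans (_ : #|D|%:R * d 0 i <= _).
    by rewrite ler_wpM2r // ler_nat.
  rewrite trB (bigID (mem D)) /= -[leLHS]addr0 lerD ?sumr_ge0 //.
  rewrite mulr_natl -sumr_const ler_sum // => j; rewrite inE => /eqP-> //.
pose w := v *m P^t*.
have vN : '[v *m N] = \sum_i d 0 i * `|w 0 i| ^+ 2.
  rewrite dotmxE trmx_mul map_mxM !mulmxA -(mulmxA v) -/B defB !mulmxA.
  rewrite -/w -[w *m _ *m P *m _]mulmxA.
  have -> : P *m v^t* = w^t* by rewrite /w trmx_mul map_mxM trmxCK.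
  rewrite mul_mx_diag mxE; apply: eq_bigr => i _.
  by rewrite !mxE normCK mulrCA mulrA.
have vv : '[v] = \sum_i `|w 0 i| ^+ 2.
  rewrite -dotmx_normE !dotmxE /w trmx_mul map_mxM trmxCK mulmxA.
  by rewrite mulmxKtV.
rewrite vN vv !mulr_sumr ler_sum // => i _.
by rewrite mulrA ler_wpM2r ?exprn_ge0.
Qed.

(** * Cayley matrices and the regular representation *)

Lemma sum_enum_val (V : nmodType) (gT : finGroupType) (G : {group gT})
    (F : gT -> V) :
  \sum_(i < gcard G) F (enum_val i) = \sum_(x in G) F x.
Proof. by rewrite [RHS]big_enum_val. Qed.

Definition cayley_mx (R : Type) (gT : finGroupType) (G : {group gT})
    (g : gT -> R) : 'M[R]_(gcard G) :=
  \matrix_(i, j) g (enum_val i * (enum_val j)^-1)%g.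

(** The entries depend only on [x * y^-1], which does not change when [x] and
    [y] are both translated on the right, and the regular representation is by
    right translations. *)
Lemma cayley_mx_comm (R : comUnitRingType) (gT : finGroupType) (G : {group gT})
    (g : gT -> R) (x : gT) :
  x \in G ->
  regular_repr R G x *m cayley_mx G g = cayley_mx G g *m regular_repr R G x.
Proof.
move=> Gx; apply/matrixP=> i j; have Gi l : enum_val l \in G := enum_valP l.
have -> : (regular_repr R G x *m cayley_mx G g) i j
          = g (enum_val i * x * (enum_val j)^-1)%g.
  have := row_mul i (regular_repr R G x) (cayley_mx G g).
  rewrite rowK -rowE => /rowP/(_ j); rewrite !mxE gring_indexK ?groupM //.
rewrite mxE (bigD1 (gring_index G (enum_val j * x^-1)%g)) //= big1 => [|l].
  rewrite !mxE !gring_indexK ?groupM ?groupV // mulgKV gring_valK !eqxx mulr1.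
  by rewrite addr0 invMg invgK mulgA.
move=> ne_l; rewrite !mxE eqxx andTb.
case: eqP => [def_j|]; last by rewrite mulr0.
case/eqP: ne_l; rewrite def_j gring_indexK ?groupM // mulgK.
by rewrite gring_valK.
Qed.

Lemma cayley_mx_adjoint (C : numClosedFieldType) (gT : finGroupType)
    (G : {group gT}) (g : gT -> C) :
  (cayley_mx G g)^t* = cayley_mx G (fun x => (g x^-1%g)^*).
Proof. by apply/matrixP=> i j; rewrite !mxE invMg invgK. Qed.

(** Right translations act transitively on the coordinates, so each coordinate
    of a fixed vector equals its coordinate at the identity. *)
Lemma fix_regular_const (F : fieldType) (gT : finGroupType) (G : {group gT})
    (m : nat) (U : 'M[F]_(m, gcard G)) :
  (U <= rfix_mx (regular_repr F G) G)%MS ->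
  (U <= (const_mx 1 : 'rV_(gcard G)))%MS.
Proof.
move=> /rfix_mxP fixU; apply/row_subP=> r.
apply/sub_rVP; exists (U r (gring_index G 1%g)).
apply/rowP=> j; rewrite !mxE mulr1.
have Gj := enum_valP j.
rewrite -[in LHS](fixU _ Gj) mxE (bigD1 (gring_index G 1%g)) //=.
rewrite big1 => [|l ne_l].
  by rewrite !mxE gring_indexK // mul1g gring_valK !eqxx mulr1 addr0.
rewrite !mxE eqxx andTb; case: eqP => [def_j|]; last by rewrite mulr0.
case/eqP: ne_l; rewrite -[l](gring_valK); congr (gring_index G _).
move/(congr1 (@enum_val _ (mem G))): def_j.
rewrite gring_indexK ?groupM ?enum_valP //.
by move/esym/(canRL (mulgK _)); rewrite mulgV.
Qed.

(** The group cannot act trivially on the eigenspace: the eigenspace would then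
    consist of constant vectors, which [B] kills because the columns of the
    Cayley matrix have sum 0, and this contradicts [a != 0]. *)
Lemma min_dim_le_rank_eigenspace (C : numClosedFieldType) (gT : finGroupType)
    (G : {group gT}) (k : nat) (g : gT -> C) (a : C) :
  min_nontrivial_dim C G k -> \sum_(x in G) g x = 0 ->
  let B := cayley_mx G g *m (cayley_mx G g)^t* in
  a != 0 -> eigenvalue B a -> (k <= \rank (eigenspace B a))%N.
Proof.
move=> [_ k_min] g0 B nz_a eig_a; set U := eigenspace B a.
have modU : mxmodule (regular_repr C G) U.
  apply/mxmoduleP=> x Gx; apply: comm_mx_stable_eigenspace.
  rewrite /comm_mx /B cayley_mx_adjoint mulmxA cayley_mx_comm //.
  by rewrite -!mulmxA cayley_mx_comm.
apply: k_min; exists (submod_repr modU).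
rewrite /nontrivial_repr rker_submod rfix_mx_rstabC //.
apply: contra eig_a => /fix_regular_const U1; rewrite -/U.
have BU1 : (const_mx 1 : 'rV_(gcard G)) *m B = 0.
  rewrite mulmxA.
  suff -> : (const_mx 1 : 'rV_(gcard G)) *m cayley_mx G g = 0.
    by rewrite mul0mx.
  apply/rowP=> j; rewrite !mxE -[RHS]g0.
  under eq_bigr do rewrite !mxE mul1r.
  rewrite (sum_enum_val _ (fun x => g (x * (enum_val j)^-1)%g)).
  rewrite (reindex_astabs 'R (enum_val j)) /=; last first.
    by rewrite astabsR ?enum_valP.
  by apply: eq_bigr => x _; rewrite mulgK.
have UB : U *m B = 0.
  by case/submxP: U1 => D ->; rewrite -mulmxA BU1 mulmx0.
have /eigenspaceP aU : (U <= U)%MS by [].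
have /eqP := etrans (esym aU) UB.
by rewrite scaler_eq0 (negPf nz_a).
Qed.

(** The left-hand sum is the inner product of [f N] with the conjugate of [h],
    where [N] is the Cayley matrix of [g]; [f N] is controlled by the
    multiplicity of the eigenvalues of [N N^*]. *)
Lemma quasirandom_mixing (C : numClosedFieldType) (gT : finGroupType)
    (G : {group gT}) (k : nat) (f g h : gT -> C) :
  min_nontrivial_dim C G k -> \sum_(x in G) g x = 0 ->
  k%:R * `|\sum_(x in G) \sum_(y in G) f x * g (x * y^-1)%g * h y| ^+ 2 <=
    #|G|%:R * (\sum_(x in G) `|f x| ^+ 2) * (\sum_(x in G) `|g x| ^+ 2)
      * (\sum_(x in G) `|h x| ^+ 2).
Proof.
move=> k_min g0; set N := cayley_mx G g.
pose v : 'rV[C]_(gcard G) := \row_i f (enum_val i).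
pose w : 'rV[C]_(gcard G) := \row_i (h (enum_val i))^*.
have -> : \sum_(x in G) \sum_(y in G) f x * g (x * y^-1)%g * h y
          = dotmx (v *m N) w.
  rewrite dotmxE mxE exchange_big /= -sum_enum_val; apply: eq_bigr => j _.
  rewrite !mxE conjCK mulr_suml -sum_enum_val; apply: eq_bigr => i _.
  by rewrite !mxE.
have vE : '[v] = \sum_(x in G) `|f x| ^+ 2.
  by rewrite dotmx_normE -sum_enum_val; apply: eq_bigr => i _; rewrite mxE.
have wE : '[w] = \sum_(x in G) `|h x| ^+ 2.
  rewrite dotmx_normE -sum_enum_val; apply: eq_bigr => i _.
  by rewrite mxE norm_conjC.
have trE : \tr (N *m N^t*) = #|G|%:R * \sum_(x in G) `|g x| ^+ 2.
  rewrite mulr_natl /mxtrace.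
  rewrite -[X in _ *+ X]card_ord -[RHS]sumr_const; apply: eq_bigr => i _.
  rewrite mxE; under eq_bigr do rewrite !mxE -normCK.
  rewrite (sum_enum_val _ (fun y => `|g (enum_val i * y^-1)%g| ^+ 2)).
  have Gi := enum_valP i.
  rewrite (reindex_inj invg_inj) /= (reindex_inj (mulgI (enum_val i)^-1%g)) /=.
  apply: eq_big => [x|x _]; first by rewrite groupV groupMl ?groupV.
  by rewrite invgK mulKVg.
have vN := dot_mulmx_le
  (fun a => @min_dim_le_rank_eigenspace C gT G k g a k_min g0) v.
apply: le_trans (_ : k%:R * ('[v *m N] * '[w]) <= _).
  by rewrite ler_wpM2l ?ler0n // CauchySchwarz.
rewrite mulrA -vE -wE ler_wpM2r //.
  by rewrite dotmx_normE sumr_ge0 // => i _; rewrite exprn_ge0.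
by rewrite (mulrAC _ '[v]) -trE.
Qed.

(** * Product-free sets *)

(** The mixing inequality for three copies of the balanced indicator of [A]. *)
Lemma product_free_card (C : numClosedFieldType) (gT : finGroupType)
    (G : {group gT}) (k : nat) (A : {set gT}) :
  min_nontrivial_dim C G k -> A \subset G -> product_free A ->
  (k * #|A| ^ 3 <= (#|G| - #|A|) ^ 3)%N.
Proof.
move=> k_min sAG pfA.
have [->|A_gt0] := posnP #|A|; first by rewrite exp0n // muln0.
have leAG := subset_leq_card sAG.
pose n : C := #|G|%:R; pose a : C := #|A|%:R; pose al := a / n.
have nz_n : n != 0 by rewrite pnatr_eq0 -lt0n cardG_gt0.
pose e x : C := (x \in A)%:R; pose b x := e x - al.
have sum_e : \sum_(x in G) e x = a.
  rewrite /a -sum1_card natr_sum (big_setID A) /= (setIidPr sAG).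
  rewrite [X in _ + X]big1 ?addr0 => [|x]; last first.
    by rewrite inE /e => /andP[/negPf->].
  by apply: eq_bigr => x; rewrite /e => ->.
have sum_cst (c : C) : \sum_(x in G) c = c * n by rewrite sumr_const -mulr_natr.
have sum_b : \sum_(x in G) b x = 0.
  by rewrite sumrB sum_e sum_cst mulfVK // subrr.
have sum_bl x : x \in G -> \sum_(y in G) b (x * y^-1)%g = 0.
  move=> Gx; rewrite -[RHS]sum_b.
  rewrite (reindex_inj invg_inj) (reindex_inj (mulgI x^-1%g)) /=.
  by apply: eq_big => y; rewrite ?groupV ?groupMl ?groupV // invgK mulKVg.
have sum_br y : y \in G -> \sum_(x in G) b (x * y^-1)%g = 0.
  move=> Gy; rewrite (reindex_inj (mulIg y)) /= -[RHS]sum_b.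
  by apply: eq_big => x; rewrite ?groupMr // mulgK.
have sum_b2 : \sum_(x in G) `|b x| ^+ 2 = a * (n - a) / n.
  transitivity (\sum_(x in G) (e x * (1 - 2 * al) + al ^+ 2)).
    apply: eq_bigr => x _; rewrite real_normK; first last.
      by rewrite rpredB ?rpred_div ?realn.
    rewrite /b /e; case: (x \in A); rewrite /=; ring.
  rewrite big_split /= -mulr_suml sum_e sum_cst /al; field; exact: nz_n.
have sum_b3 : \sum_(x in G) \sum_(y in G) b x * b (x * y^-1)%g * b y
              = - (al * a ^+ 2).
  (* The middle factor sums to 0 over [x] and over [y], so the outer two factors
     may be replaced by indicators. *)
  transitivity (\sum_(x in G) \sum_(y in G) e x * b (x * y^-1)%g * b y).
    rewrite exchange_big [RHS]exchange_big; apply: eq_bigr => y Gy /=.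
    apply/eqP; rewrite -subr_eq0 -sumrB.
    rewrite (eq_bigr (fun x => b (x * y^-1)%g * (- al * b y))) => [|x _].
      by rewrite -mulr_suml sum_br // mul0r.
    by rewrite [b x]/b; ring.
  transitivity (\sum_(x in G) \sum_(y in G) e x * b (x * y^-1)%g * e y).
    apply: eq_bigr => x Gx; apply/eqP; rewrite -subr_eq0 -sumrB.
    rewrite (eq_bigr (fun y => b (x * y^-1)%g * (- al * e x))) => [|y _].
      by rewrite -mulr_suml sum_bl // mul0r.
    by rewrite [b y]/b; ring.
  (* [x * y^-1] and [y] in [A] would put their product [x] in [A], so the
     indicator part of the middle factor contributes nothing. *)
  transitivity (\sum_(x in G) \sum_(y in G) - (al * e x) * e y).
    apply: eq_bigr => x _; apply: eq_bigr => y _.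
    rewrite /b /e.
    case Ax: (x \in A); case Ay: (y \in A); rewrite ?(mulr0, mul0r, oppr0) //.
    case Az: (x * y^-1 \in A)%g; last by rewrite /=; ring.
    by have := pfA _ _ Az Ay; rewrite mulgKV Ax.
  under eq_bigr do rewrite -mulr_sumr sum_e.
  by rewrite -mulr_suml sumrN -mulr_sumr sum_e; ring.
have := @quasirandom_mixing C gT G k b b b k_min sum_b.
have al_ge0 : 0 <= al * a ^+ 2.
  by rewrite mulr_ge0 ?exprn_ge0 // ?divr_ge0 // ler0n.
rewrite sum_b2 sum_b3 normrN ger0_norm // -/n.
have a_gt0 : 0 < a by rewrite ltr0n.
have n_gt0 : 0 < n by rewrite ltr0n cardG_gt0.
rewrite -(ler_nat C) natrM !natrX natrB // -/n -/a => le_k.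
(* The mixing inequality is the wanted one multiplied by this constant. *)
have c_gt0 : 0 < a ^+ 3 / n ^+ 2 by rewrite divr_gt0 ?exprn_gt0.
rewrite -(ler_pM2l c_gt0).
apply: etrans le_k; congr (_ <= _); rewrite /al; field; exact: nz_n.
Qed.

Theorem theoremA2 (R : realType) (gT : finGroupType) (Gamma : {group gT})
    (k : nat) (A : {set gT}) :
  min_nontrivial_dim (R[i]%C : fieldType) Gamma k ->
  A \subset Gamma ->
  product_free A ->
  #|A|%:R <= #|Gamma|%:R / (1 + k%:R `^ (3%:R^-1)) :> R.
Proof.
move=> k_min sAG pfA; have leAG := subset_leq_card sAG.
have le_k := product_free_card (C := R[i]%C) k_min sAG pfA.
set r := k%:R `^ _; have r_ge0 : 0 <= r := powR_ge0 _ _.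
have r3 : r ^+ 3 = k%:R.
  by rewrite -powR_mulrn // -powRrM mulVf ?powRr1 ?ler0n // pnatr_eq0.
rewrite ler_pdivlMr ?ltr_pwDl // mulrDr mulr1 addrC -lerBrDr -natrB //.
rewrite -(@ler_pXn2r _ 3) ?nnegrE ?mulr_ge0 ?ler0n // exprMn r3.
by rewrite -!natrX -natrM ler_nat mulnC.
Qed.
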